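(* Let $x(j)$, $j=0,1,2,\dots$, be a sequence of integers with $x(0)=1$, and with $x(1)$ and $x(2)$ odd. Then the coefficients $v_{\mathbf x}(n)$ in the expansion $$\sum_{n\ge0}\frac{v_{\mathbf x}(n)}{2^n\,(2n)!}t^{2n}=\Bigl(1+\sum_{j\ge1}\frac{x(j)}{(2j)!}t^{2j}\Bigr)^{1/2}$$ are integers. Moreover, for all integers $e\ge3$, the sequence $(v_{\mathbf x}(n))_{n\ge0}$ is purely periodic modulo $2^e$ with (not necessarily minimal) period length $2^{e-1}$.
   Context: The square root denotes the formal power series square root with constant term $1$. A sequence $(a(n))_{n\ge0}$ is purely periodic modulo $M$ with (not necessarily minimal) period length $L$ if $a(n+L)\equiv a(n)\pmod M$ for all $n\ge0$. *)

(* Defs.v *)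
From mathcomp Require Import all_boot all_order all_algebra.
From mathcomp Require Import ring lra.

Set Implicit Arguments.
Unset Strict Implicit.
Unset Printing Implicit Defensive.

Import Order.TTheory GRing.Theory Num.Theory.
Local Open Scope ring_scope.

(* Formal power series over rat in one variable t are coefficient sequences
   f : nat -> rat, compared pointwise (=1). *)

Definition fps_mul (f g : nat -> rat) : nat -> rat :=
  fun n => \sum_(i < n.+1) f i * g (n - i)%N.

(* \sum_n a(n) t^(2n) *)
Definition fps_even (a : nat -> rat) : nat -> rat :=
  fun k => if odd k then 0 else a k./2.

(* s = f^(1/2), the square root with constant term 1; s is determined by f,
   see is_fps_sqrt_unique. *)
Definition is_fps_sqrt (s f : nat -> rat) : Prop :=
  s 0%N = 1 /\ fps_mul s s =1 f.

Lemma is_fps_sqrt_unique (s s' f : nat -> rat) :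
  is_fps_sqrt s f -> is_fps_sqrt s' f -> s =1 s'.
Proof.
move=> [s0 sf] [s0' sf'] n.
elim/ltn_ind: n => -[_|n IH]; first by rewrite s0 s0'.
have split_ends (u : nat -> rat) : fps_mul u u n.+1 =
    u 0%N * u n.+1 + \sum_(i < n) u i.+1 * u (n - i)%N + u n.+1 * u 0%N.
  by rewrite /fps_mul big_ord_recr big_ord_recl /= subn0 subnn.
have := sf n.+1; rewrite -(sf' n.+1) !split_ends s0 s0'.
rewrite (eq_bigr (fun i : 'I_n => s' i.+1 * s' (n - i)%N)); first by lra.
by move=> i _; rewrite !IH // ltnS ?leq_subr.
Qed.

(* 1 + \sum_(j >= 1) x(j) / (2j)! t^(2j) *)
Definition radicand (x : nat -> int) : nat -> rat :=
  fps_even (fun j => if j == 0%N then 1 else (x j)%:~R / ((2 * j)`!)%:R).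

(* \sum_(n >= 0) v(n) / (2^n (2n)!) t^(2n) *)
Definition expansion (v : nat -> int) : nat -> rat :=
  fps_even (fun n => (v n)%:~R / (2 ^+ n * ((2 * n)`!)%:R)).

Definition purely_periodic_mod (a : nat -> int) (M : int) (L : nat) : Prop :=
  forall n : nat, (a (n + L)%N = a n %[mod M])%Z.

(* Main.v *)
Require Import Defs.
From mathcomp Require Import all_boot all_order all_algebra.
From mathcomp Require Import ring zify.

(** The idea is to write the square root explicitly in terms of integers.
    Divide the factor two out of the radicand, F = 1 + 2H.  Expanding the
    power 1/2 binomially,
      sqrt F = sum_m (1)(-1)(-3)...(3-2m) H^m/m!,
    and if H has integer coefficients as an exponential generating function
    then so has every divided power H^m/m!.  After rescaling t by sqrt 2, the
    numbers v(n) are the coefficients of such a square root, with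
    H = sum_(n >= 1) 2^(n-1) x(n) t^(2n)/(2n)!, so they are integers
    ([half_pow_sqr], [expansion_sqrt]).

    For the period, put z = t^2/2.  Since t^(2n)/(2n)! = z^n/(n! (2n-1)!!),
    one gets v(n) = (2n-1)!! u(n), where u belongs in the same way to
    y(n) = x(n)/(2n-1)!! and to the variable z ([half_pow_double]).  Modulo
    2^e the odd number (2n-1)!! is invertible, so y may be taken integral; and
    (2n-1)!! has period L = 2^(e-1) modulo 2^e, because L consecutive odd
    numbers have product 1 ([prod_odd_mod]).  It remains to see that u has
    period L.

    Split H = y(1) z + R, where R starts in degree two.  The binomial series
    in R gives ([half_pow_split])
      u(n) = sum_(m, c) 'C(n, c) W(m, c) y(1)^(n-c) E(m+n-c),
    with W(m, c) the coefficients of R^m/m! and E(k) = (1)(-1)...(3-2k).  The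
    last two factors have period L by [odd_exp_mod] and [half_coef_periodic].
    Moreover 2^(c-m) divides W(m, c), which vanishes for c < 2m, whereas
    2^d 'C(n, c) has period L when c < 2^d ([bin_shift_mod]).  With d = c - m
    this covers every pair but (m, c) = (1, 2) and (m, c) = (2, 4).  There
    c = 2^d, and the increment from n to n + L is congruent to L
    ([bin_shift_pow2_mod]) instead of 0; the two failures contribute L y(2)
    each, and cancel modulo 2L ([bin_dpow_tail_mod], [half_pow_periodic]). *)

Set Implicit Arguments.
Unset Strict Implicit.
Unset Printing Implicit Defensive.

Import Order.TTheory GRing.Theory Num.Theory.
Local Open Scope ring_scope.

(** * Exponential generating functions *)

(** A sequence f stands for the series of general term f(n) t^n/n!. *)
Definition hmul (R : comNzRingType) (f g : nat -> R) (n : nat) : R :=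
  \sum_(i < n.+1) 'C(n, i)%:R * f i * g (n - i)%N.

Definition hder (R : comNzRingType) (f : nat -> R) (n : nat) : R := f n.+1.

Definition hone (R : comNzRingType) (n : nat) : R := (n == 0%N)%:R.

Lemma eq_hmul (R : comNzRingType) (f f' g g' : nat -> R) n :
    (forall i, (i <= n)%N -> f i = f' i) ->
    (forall i, (i <= n)%N -> g i = g' i) ->
  hmul f g n = hmul f' g' n.
Proof.
move=> ef eg; apply: eq_bigr => i _.
by rewrite ef ?eg ?leq_subr // -ltnS.
Qed.

Lemma hmulC (R : comNzRingType) (f g : nat -> R) n : hmul f g n = hmul g f n.
Proof.
rewrite /hmul (reindex_inj rev_ord_inj) /=; apply: eq_bigr => i _.
have le_in : (i <= n)%N by rewrite -ltnS.
by rewrite subSS subKn // bin_sub //; ring.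
Qed.

Lemma hmul_at0 (R : comNzRingType) (f g : nat -> R) : hmul f g 0 = f 0%N * g 0%N.
Proof. by rewrite /hmul big_ord1 bin0 mul1r. Qed.

Lemma hmul1l (R : comNzRingType) (f : nat -> R) n : hmul (hone R) f n = f n.
Proof.
rewrite /hmul big_ord_recl bin0 subn0 !mul1r big1 ?addr0 // => i _.
by rewrite /hone mulr0 mul0r.
Qed.

Lemma hmulDl (R : comNzRingType) (f g h : nat -> R) n :
  hmul (fun i => f i + g i) h n = hmul f h n + hmul g h n.
Proof. by rewrite /hmul -big_split; apply: eq_bigr => i _ /=; ring. Qed.

Lemma hmulDr (R : comNzRingType) (f g h : nat -> R) n :
  hmul h (fun i => f i + g i) n = hmul h f n + hmul h g n.
Proof. by rewrite !(hmulC h) hmulDl. Qed.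

Lemma hmulZr (R : comNzRingType) a (f g : nat -> R) n :
  hmul f (fun i => a * g i) n = a * hmul f g n.
Proof. by rewrite /hmul mulr_sumr; apply: eq_bigr => i _; ring. Qed.

Lemma hmulZl (R : comNzRingType) a (f g : nat -> R) n :
  hmul (fun i => a * f i) g n = a * hmul f g n.
Proof. by rewrite hmulC hmulZr hmulC. Qed.

Lemma hmul_sumr (R : comNzRingType) (N : nat) (f : nat -> R) (g : nat -> nat -> R) n :
  hmul f (fun i => \sum_(m < N) g m i) n = \sum_(m < N) hmul f (g m) n.
Proof.
rewrite /hmul exchange_big /=; apply: eq_bigr => i _.
by rewrite mulr_sumr.
Qed.

(** Leibniz' rule.  With the value at 0 it determines a product, so identities
    between products are proved below by differentiating them. *)
Lemma hmul_der (R : comNzRingType) (f g : nat -> R) n :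
  hmul f g n.+1 = hmul (hder f) g n + hmul f (hder g) n.
Proof.
rewrite {1}/hmul big_ord_recl bin0 subn0 mul1r.
under eq_bigr => i _ do rewrite /= /bump add1n binS natrD !mulrDl subSS.
rewrite big_split /= addrA addrC.
congr (_ + _).
have -> : hmul f (hder g) n = \sum_(i < n.+2) 'C(n, i)%:R * f i * g (n.+1 - i)%N.
  rewrite big_ord_recr /= bin_small // !mul0r addr0; apply: eq_bigr => i _.
  by rewrite /hder subSn // -ltnS.
by rewrite [RHS]big_ord_recl bin0 subn0 mul1r; congr (_ + _).
Qed.

Lemma hmulA (R : comNzRingType) (f g h : nat -> R) n :
  hmul f (hmul g h) n = hmul (hmul f g) h n.
Proof.
elim: n f g h => [|n IH] f g h; first by rewrite !hmul_at0 mulrA.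
rewrite 2!hmul_der.
rewrite (@eq_hmul _ f f (hder (hmul g h))
  (fun i => hmul (hder g) h i + hmul g (hder h) i)) //; last first.
  by move=> i _; rewrite /hder hmul_der.
rewrite (@eq_hmul _ (hder (hmul f g))
  (fun i => hmul (hder f) g i + hmul f (hder g) i) h h) //; last first.
  by move=> i _; rewrite /hder hmul_der.
by rewrite hmulDl hmulDr !IH addrA.
Qed.

Lemma hmulCA (R : comNzRingType) (f g h : nat -> R) n :
  hmul f (hmul g h) n = hmul g (hmul f h) n.
Proof.
by rewrite !hmulA; apply: eq_hmul => // i _; rewrite hmulC.
Qed.

(** The divided power H^m/m!, as the iterated primitive of H' H^(m-1)/(m-1)!:
    no division occurs, so the coefficients stay in R. *)
Fixpoint dpow (R : comNzRingType) (h : nat -> R) (m : nat) : nat -> R :=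
  if m isn't m'.+1 then hone R
  else fun n => if n is n'.+1 then hmul (hder h) (dpow h m') n' else 0.

Lemma dpow_small (R : comNzRingType) (h : nat -> R) m n :
  (n < m)%N -> dpow h m n = 0.
Proof.
elim: m n => [|m IH] [|n] //= ltnm; rewrite /hmul big1 // => i _.
by rewrite IH ?mulr0 //; move: ltnm; case: i => i /=; lia.
Qed.

(** * The square root of 1 + 2H *)

(** This is k! 2^k times the binomial coefficient of 1/2 over k. *)
Definition half_coef (k : nat) : int := \prod_(i < k) (1 - 2 * i%:Z).

Lemma half_coefS k : half_coef k.+1 = half_coef k * (1 - 2 * k%:Z).
Proof. by rewrite /half_coef big_ord_recr. Qed.

(** The series half_coef k * (1 + 2H)^(1/2 - k).  The normalisation makes
    differentiation a mere shift of k, see [half_pow_der].  Divided powers of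
    exponent above n have no coefficient of index n, whence the bound. *)
Definition half_pow (h : nat -> int) (k n : nat) : int :=
  \sum_(m < n.+1) half_coef (k + m) * dpow h m n.

Lemma half_pow_at0 h k : half_pow h k 0 = half_coef k.
Proof. by rewrite /half_pow big_ord1 addn0 mulr1. Qed.

Lemma half_pow_widen h k n N : (n < N)%N ->
  half_pow h k n = \sum_(m < N) half_coef (k + m) * dpow h m n.
Proof.
move=> ltnN; rewrite /half_pow.
rewrite (big_ord_widen _ (fun m => half_coef (k + m) * dpow h m n) ltnN).
rewrite [RHS](bigID (fun m : 'I_N => (m < n.+1)%N)) /= [X in _ + X]big1 ?addr0 //.
by move=> i; rewrite -leqNgt => ltni; rewrite dpow_small ?mulr0.
Qed.

Lemma half_pow_der h k n :
  half_pow h k n.+1 = hmul (hder h) (half_pow h k.+1) n.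
Proof.
rewrite /half_pow big_ord_recl /= /hone mulr0 add0r.
rewrite (@eq_hmul _ _ (hder h) _
  (fun i => \sum_(m < n.+1) half_coef (k.+1 + m) * dpow h m i)) //; last first.
  by move=> i lein; apply: half_pow_widen.
rewrite (hmul_sumr _ _ (fun m i => half_coef (k.+1 + m) * dpow h m i)).
apply: eq_bigr => i _.
by rewrite hmulZr /bump add1n addnS.
Qed.

Definition one_plus_double (h : nat -> int) (n : nat) : int := hone int n + 2 * h n.

(** Both sides have the same derivative, by induction on the index for k + 1:
    with U_k for half_pow h k and F for 1 + 2H, that of the left side is
    2H' U_(k+1) + H' (F U_(k+2)) = (2 + 1 - 2(k+1)) H' U_(k+1). *)
Lemma half_pow_mul h k n : h 0%N = 0 ->
  hmul (one_plus_double h) (half_pow h k.+1) n = (1 - 2 * k%:Z) * half_pow h k n.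
Proof.
move=> h0; elim/ltn_ind: n k => -[_|n IH] k.
  by rewrite hmul_at0 !half_pow_at0 /one_plus_double h0 mulr0 mul1r mulrC half_coefS.
rewrite hmul_der.
have -> : hmul (hder (one_plus_double h)) (half_pow h k.+1) n =
    2 * hmul (hder h) (half_pow h k.+1) n.
  by rewrite -hmulZl; apply: eq_hmul => // i _; rewrite /hder /one_plus_double add0r.
have -> : hmul (one_plus_double h) (hder (half_pow h k.+1)) n =
    (1 - 2 * k.+1%:Z) * hmul (hder h) (half_pow h k.+1) n.
  transitivity (hmul (one_plus_double h) (hmul (hder h) (half_pow h k.+2)) n).
    by apply: eq_hmul => // i _; rewrite -half_pow_der.
  by rewrite hmulCA -hmulZr; apply: eq_hmul => // i lein; rewrite IH.
by rewrite half_pow_der -mulrDl; congr (_ * _); lia.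
Qed.

(** With the notation above, U_0 = F U_1 and F U_2 = - U_1, so that
    (U_0 U_1)' = H' U_1 U_1 + U_1 H' (F U_2) = 0. *)
Lemma half_pow_inv h n : h 0%N = 0 ->
  hmul (half_pow h 0) (half_pow h 1) n = hone int n.
Proof.
move=> h0; case: n => [|n].
  by rewrite hmul_at0 !half_pow_at0 half_coefS /half_coef big_ord0.
rewrite hmul_der /hone /=.
suff -> : hmul (half_pow h 0) (hder (half_pow h 1)) n =
    - hmul (hder (half_pow h 0)) (half_pow h 1) n by rewrite subrr.
transitivity (hmul (half_pow h 1) (hmul (one_plus_double h) (hder (half_pow h 1))) n).
  rewrite hmulCA hmulA; apply: eq_hmul => // i _.
  by rewrite half_pow_mul // mulr0 subr0 mul1r.
rewrite [in RHS]hmulC -mulN1r -hmulZr; apply: eq_hmul => // i _.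
transitivity (hmul (hder h) (hmul (one_plus_double h) (half_pow h 2)) i).
  by rewrite [RHS]hmulCA; apply: eq_hmul => // j _; rewrite -half_pow_der.
rewrite {2}/hder half_pow_der -hmulZr; apply: eq_hmul => // j _.
by rewrite half_pow_mul.
Qed.

(** U_0 U_0 = U_0 (F U_1) = F (U_0 U_1) = F. *)
Lemma half_pow_sqr h n : h 0%N = 0 ->
  hmul (half_pow h 0) (half_pow h 0) n = one_plus_double h n.
Proof.
move=> h0.
transitivity (hmul (half_pow h 0) (hmul (one_plus_double h) (half_pow h 1)) n).
  apply: eq_hmul => // i _.
  by rewrite half_pow_mul // mulr0 subr0 mul1r.
rewrite hmulCA hmulC -[RHS]hmul1l; apply: eq_hmul => // i _.
by rewrite half_pow_inv.
Qed.

(** * Even series, and the variable t^2/2 *)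

Lemma sum_even_ord (R : comNzRingType) (F : nat -> R) n :
    (forall i, odd i -> F i = 0) ->
  \sum_(i < n.*2.+1) F i = \sum_(j < n.+1) F j.*2.
Proof.
move=> F0; elim: n => [|n IH]; first by rewrite !big_ord1.
rewrite doubleS 2!big_ord_recr IH [RHS]big_ord_recr /=.
by rewrite F0 ?addr0 //= odd_double.
Qed.

Lemma hmul_even (R : comNzRingType) (f g : nat -> R) n :
    (forall i, odd i -> f i = 0) ->
  hmul f g n.*2 = \sum_(j < n.+1) 'C(n.*2, j.*2)%:R * f j.*2 * g (n - j).*2%N.
Proof.
move=> f0; rewrite /hmul.
rewrite (sum_even_ord _
  (F := fun i => 'C(n.*2, i)%:R * f i * g (n.*2 - i)%N)).
  by apply: eq_bigr => j _; rewrite doubleB.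
by move=> i oddi; rewrite f0 // mulr0 mul0r.
Qed.

Lemma expansion_sqrt (v x : nat -> int) :
    x 0%N = 1 -> v 0%N = 1 ->
    (forall n, \sum_(j < n.+1) 'C(n.*2, j.*2)%:R * v j * v (n - j)%N
               = 2 ^+ n * x n) ->
  is_fps_sqrt (expansion v) (radicand x).
Proof.
move=> x0 v0 v2; split=> [|k].
  by rewrite /expansion /fps_even /= v0 muln0 fact0.
case oddk: (odd k).
  rewrite /radicand /fps_even oddk /fps_mul big1 // => i _.
  rewrite /expansion /fps_even; case oddi: (odd i); first by rewrite mul0r.
  by rewrite oddB -1?ltnS // oddk oddi mulr0.
have {oddk} [n ->] : exists n, k = n.*2.
  by exists k./2; rewrite -[LHS]odd_double_half oddk.
rewrite /fps_mul (sum_even_ord _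
  (F := fun i => expansion v i * expansion v (n.*2 - i)%N)); last first.
  by move=> i oddi; rewrite /expansion /fps_even oddi mul0r.
have -> : radicand x n.*2 = (2 ^+ n * x n)%:~R / (2 ^+ n * ((2 * n)`!)%:R).
  rewrite /radicand /fps_even odd_double doubleK.
  have n2 : (2 ^+ n : rat) != 0 by rewrite expf_neq0.
  rewrite intrM rmorphXn /= -mulf_div divff // mul1r.
  by case: eqP => // ->; rewrite x0 muln0 fact0 divr1.
rewrite -v2 rmorph_sum /= mulr_suml; apply: eq_bigr => i _.
have lein : (i <= n)%N by rewrite -ltnS.
rewrite /expansion /fps_even -doubleB !odd_double !doubleK.
rewrite !intrM -!mul2n -(bin_fact (_ : 2 * i <= 2 * n)%N) ?leq_mul2l //.
have -> : (2 ^+ n : rat) = 2 ^+ i * 2 ^+ (n - i) by rewrite -exprD subnKC.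
rewrite -mulnBr !natrM.
have f2 m : (m`!%:R : rat) != 0 by rewrite pnatr_eq0 -lt0n fact_gt0.
have b2 : ('C(2 * n, 2 * i)%:R : rat) != 0.
  by rewrite pnatr_eq0 -lt0n bin_gt0 leq_mul2l.
have n2 m : (2 ^+ m : rat) != 0 by rewrite expf_neq0.
field.
by rewrite b2 !n2 !f2.
Qed.

Lemma half_pow_odd (h : nat -> int) k n :
  (forall i, odd i -> h i = 0) -> odd n -> half_pow h k n = 0.
Proof.
move=> h_odd; elim/ltn_ind: n k => -[//|n IH] k /= evn.
rewrite half_pow_der /hmul big1 // => i _; rewrite /hder.
case oddi: (odd i); last by rewrite h_odd ?mulr0 ?mul0r //= oddi.
rewrite IH ?mulr0 ?ltnS ?leq_subr // oddB -1?ltnS // oddi.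
by case: (odd n) evn.
Qed.

(** The double factorial (2n-1)!!. *)
Definition odd_fact (n : nat) : nat := (\prod_(i < n) i.*2.+1)%N.

Lemma fact_double n : (n.*2`! = odd_fact n * (2 ^ n * n`!))%N.
Proof.
elim: n => [|n IH]; first by rewrite /odd_fact big_ord0.
by rewrite doubleS !factS IH /odd_fact big_ord_recr /= expnS -!mul2n; lia.
Qed.

Lemma bin_odd_fact n j : (j <= n)%N ->
  ('C(n.*2.+1, j.*2.+1) * (odd_fact j.+1 * odd_fact (n - j)) =
   odd_fact n.+1 * 'C(n, j))%N.
Proof.
move=> lejn.
have fact_odd m : (m.*2.+1`! = odd_fact m.+1 * (2 ^ m * m`!))%N.
  by rewrite factS fact_double /odd_fact big_ord_recr /=; lia.
have c_gt0 : (0 < 2 ^ n * (j`! * (n - j)`!))%N by rewrite !muln_gt0 expn_gt0 !fact_gt0.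
apply/eqP; rewrite -(eqn_pmul2r c_gt0); apply/eqP.
have := bin_fact (_ : j.*2.+1 <= n.*2.+1)%N; rewrite ltnS leq_double lejn => /(_ isT).
rewrite subSS -doubleB fact_double !fact_odd => E.
have e2 : (2 ^ n = 2 ^ j * 2 ^ (n - j))%N by rewrite -expnD subnKC.
transitivity ('C(n.*2.+1, j.*2.+1) *
       (odd_fact j.+1 * (2 ^ j * j`!) *
        (odd_fact (n - j) * (2 ^ (n - j) * (n - j)`!))))%N.
  rewrite e2.
  by move: (2 ^ j)%N (2 ^ (n - j))%N j`! (n - j)`! (odd_fact j.+1)
    (odd_fact _) 'C(_, _) => *; ring.
rewrite E e2 -(bin_fact lejn).
by move: (2 ^ j)%N (2 ^ (n - j))%N j`! (n - j)`! (odd_fact n.+1) 'C(_, _) => *; ring.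
Qed.

(** If H is even in t, it is a series in z = t^2/2, and so is its power; the
    coefficients of t^(2n)/(2n)! and z^n/n! differ by the factor (2n-1)!!. *)
Lemma half_pow_double (g h : nat -> int) k n :
    (forall i, odd i -> g i = 0) ->
    (forall i, g i.*2 = (odd_fact i)%:R * h i) ->
  half_pow g k n.*2 = (odd_fact n)%:R * half_pow h k n.
Proof.
move=> g_odd g_even; elim/ltn_ind: n k => -[_|n IH] k.
  by rewrite !half_pow_at0 /odd_fact big_ord0 mul1r.
rewrite doubleS !half_pow_der /hmul.
rewrite big_ord_recl /hder g_odd // mulr0 mul0r add0r.
rewrite (sum_even_ord _ (F := fun i =>
  'C(n.*2.+1, i.+1)%:R * g i.+2 * half_pow g k.+1 (n.*2.+1 - i.+1)%N)); last first.
  by move=> i oddi; rewrite g_odd ?mulr0 ?mul0r //= oddi.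
rewrite mulr_sumr; apply: eq_bigr => i _.
have lein : (i <= n)%N by rewrite -ltnS.
rewrite subSS -doubleB -doubleS g_even IH ?ltnS ?leq_subr //.
transitivity (('C(n.*2.+1, i.*2.+1) * (odd_fact i.+1 * odd_fact (n - i)))%N%:R *
  (h i.+1 * half_pow h k.+1 (n - i)%N)); first by rewrite !natrM; ring.
rewrite bin_odd_fact // natrM; ring.
Qed.

(** * Congruences for powers and products of odd numbers *)

Lemma dvdz_mulB (M a a' b b' : int) :
  (M %| a - a' -> M %| b - b' -> M %| a * b - a' * b')%Z.
Proof.
move=> Ma Mb.
have -> : a * b - a' * b' = (a - a') * b + a' * (b - b') by ring.
by rewrite rpredD //; [apply: dvdz_mulr | apply: dvdz_mull].
Qed.

Lemma dvdz_sumB (M : int) (I : finType) (F G : I -> int) :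
  (forall i, M %| F i - G i)%Z -> (M %| \sum_i F i - \sum_i G i)%Z.
Proof. by move=> FG; rewrite -sumrB rpred_sum. Qed.

Lemma dvdz_prodB (M : int) (I : finType) (F G : I -> int) :
  (forall i, M %| F i - G i)%Z -> (M %| \prod_i F i - \prod_i G i)%Z.
Proof.
move=> FG; apply: (big_rec2 (fun a b => (M %| a - b)%Z)); first by rewrite subrr.
by move=> i a b _; apply: dvdz_mulB.
Qed.

(** The coefficients of the power are integral polynomials in those of H. *)
Lemma dvdz_half_powB (M : int) (g h : nat -> int) k n :
    (forall i, M %| g i - h i)%Z ->
  (M %| half_pow g k n - half_pow h k n)%Z.
Proof.
move=> gh; elim/ltn_ind: n k => -[_|n IH] k.
  by rewrite !half_pow_at0 subrr.
rewrite !half_pow_der; apply: dvdz_sumB => i.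
apply: dvdz_mulB; last by apply: IH; rewrite ltnS leq_subr.
by apply: dvdz_mulB; [rewrite subrr dvdz0 | apply: gh].
Qed.

Lemma odd_sqr_mod (a : int) k :
  (2 ^+ k.+1 %| a - 1 -> 2 ^+ k.+2 %| a ^+ 2 - 1)%Z.
Proof.
move=> /dvdzP [b E]; have -> : a = b * 2 ^+ k.+1 + 1 by rewrite -E subrK.
apply/dvdzP; exists (b ^+ 2 * 2 ^+ k + b); rewrite !exprS; ring.
Qed.

Lemma odd_exp_mod (a : int) k :
  odd `|a|%N -> (2 ^+ k.+1 %| a ^+ (2 ^ k) - 1)%Z.
Proof.
move=> odda; elim: k => [|k IH].
  by rewrite expr1 expn0 expr1; lia.
by rewrite expnSr exprM; apply: odd_sqr_mod.
Qed.

Lemma prod_pair (R : comNzRingType) (F : nat -> R) n :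
  \prod_(i < n.*2) F i = \prod_(i < n) (F i.*2 * F i.*2.+1).
Proof.
elim: n => [|n IH]; first by rewrite !big_ord0.
by rewrite doubleS 2!big_ord_recr IH [RHS]big_ord_recr /= mulrA.
Qed.

(** Two consecutive factors b and b + 2 shifted by s = 2^(k+1) become
    (b + s)(b + 2 + s) = b (b + 2) + s (2b + 2 + s), and s is even: pairing
    the factors gains one power of 2. *)
Lemma prod_odd_shift_mod (a : int) k n : odd `|a|%N ->
  (2 ^+ k.+2 %| \prod_(i < n.*2) (a + 2 ^+ k.+1 + 2 * i%:Z)
                - \prod_(i < n.*2) (a + 2 * i%:Z))%Z.
Proof.
move=> odda; rewrite (prod_pair (fun i => a + 2 ^+ k.+1 + 2 * i%:Z)).
rewrite (prod_pair (fun i => a + 2 * i%:Z)); apply: dvdz_prodB => i.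
have [b ->] : exists b, a = 2 * b + 1 by exists ((a - 1) %/ 2)%Z; lia.
apply/dvdzP.
exists (2 * b + 2 * (i.*2)%:Z + 2 + 2 ^+ k); rewrite !exprS.
have -> : Posz i.*2.+1 = Posz i.*2 + 1 by lia.
ring.
Qed.

(** If p is the product of the first half of the factors, the second half is
    congruent to p by [prod_odd_shift_mod], so the whole is congruent to p^2,
    and squaring gains one power of 2. *)
Lemma prod_odd_mod (a : int) k : odd `|a|%N ->
  (2 ^+ k.+3 %| \prod_(i < 2 ^ k.+2) (a + 2 * i%:Z) - 1)%Z.
Proof.
move=> odda; elim: k => [|k IH].
  rewrite !big_ord_recl big_ord0 /= /bump /=.
  have [b ->] : exists b, a = 2 * b + 1 by exists ((a - 1) %/ 2)%Z; lia.
  apply/dvdzP; exists ((2 * b ^+ 2 + 8 * b + 3) * (b ^+ 2 + 4 * b + 2)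
                       + (4 * b ^+ 2 + 16 * b + 7)).
  ring.
have -> : (2 ^ k.+3 = 2 ^ k.+2 + 2 ^ k.+2)%N by rewrite expnS mul2n addnn.
rewrite big_split_ord /=.
have := @odd_sqr_mod _ _ IH.
set p := \prod_(i < _) _; set q := \prod_(i < _) _ => p2.
have pq : (2 ^+ k.+4 %| q - p)%Z.
  have := @prod_odd_shift_mod a k.+2 (2 ^ k.+1) odda.
  rewrite -mul2n -expnS -/p.
  have -> // : \prod_(i < 2 ^ k.+2) (a + 2 ^+ k.+3 + 2 * i%:Z) = q.
  apply: eq_bigr => i _.
  have E2 : Posz (2 ^ k.+2)%N = 2 ^+ k.+2 by rewrite -natz natrX.
  by rewrite PoszD mulrDr addrA E2 -exprS.
have -> : p * q - 1 = p ^+ 2 - 1 + p * (q - p) by ring.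
by rewrite rpredD // dvdz_mull.
Qed.

Lemma half_coef_periodic k s :
  (2 ^+ s.+3 %| half_coef (k + 2 ^ s.+2) - half_coef k)%Z.
Proof.
rewrite /half_coef big_split_ord /= -[X in _ - X]mulr1 -mulrBr dvdz_mull //.
rewrite (eq_bigr (fun i : 'I_(2 ^ s.+2) => -1 * (2 * k%:Z - 1 + 2 * i%:Z))); last first.
  by move=> i _; lia.
rewrite big_split /= prodr_const card_ord -signr_odd oddX mul1r.
by apply: prod_odd_mod; lia.
Qed.

Lemma odd_fact_periodic n s :
  (2 ^+ s.+3 %| (odd_fact (n + 2 ^ s.+2))%:Z - (odd_fact n)%:Z)%Z.
Proof.
rewrite /odd_fact big_split_ord /= PoszM -[X in _ - X]mulr1 -mulrBr dvdz_mull //.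
rewrite -[X in X - 1]natz natr_prod.
rewrite (eq_bigr (fun i : 'I_(2 ^ s.+2) => (2 * n%:Z + 1 + 2 * i%:Z))); last first.
  by move=> i _; rewrite natz; lia.
by apply: prod_odd_mod; lia.
Qed.

Lemma odd_odd_fact n : odd (odd_fact n).
Proof.
elim: n => [|n IH]; first by rewrite /odd_fact big_ord0.
by rewrite /odd_fact big_ord_recr oddM /= odd_double andbT.
Qed.

Lemma odd_half_coef n : odd `|half_coef n|%N.
Proof.
elim: n => [|n IH]; first by rewrite /half_coef big_ord0.
by rewrite half_coefS abszM oddM IH; lia.
Qed.

(** * Splitting off the linear term *)

Definition tail_from2 (h : nat -> int) (n : nat) : int :=
  if (n <= 1)%N then 0 else h n.

(** With a = h 1 and H = a z + R, this is the binomial expansion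
    (1 + 2H)^(1/2-k) = sum_m c_m R^m/m! (1 + 2az)^(1/2-k-m),
    where a power of 1 + 2az has explicit coefficients.  It is checked on
    derivatives, using H' = a + R'. *)
Lemma half_pow_split h k n N : (n < N)%N ->
  half_pow h k n = \sum_(m < N)
     hmul (dpow (tail_from2 h) m) (fun j => h 1%N ^+ j * half_coef (k + m + j)) n.
Proof.
set r := tail_from2 h; set a := h 1%N.
pose q k j := a ^+ j * half_coef (k + j).
have q_der k' i : hder (q k') i = a * q k'.+1 i.
  by rewrite /hder /q exprS addnS addSn mulrA.
elim/ltn_ind: n k N => -[_|n IH] k [//|N] ltnN.
  rewrite big_ord_recl hmul_at0 half_pow_at0 !mul1r !addn0 big1 ?addr0 // => i _.
  by rewrite hmul_at0 mul0r.
rewrite half_pow_der.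
have -> : hmul (hder h) (half_pow h k.+1) n =
    hmul (hder r) (half_pow h k.+1) n + a * half_pow h k.+1 n.
  rewrite -[X in _ * X]hmul1l -hmulZl -hmulDl; apply: eq_hmul => // -[|i] _.
    by rewrite /hder /r /tail_from2 /= add0r mulr1.
  by rewrite /hder /r /tail_from2 /= mulr0 addr0.
under [RHS]eq_bigr => m _ do rewrite hmul_der.
rewrite big_split /=; congr (_ + _); last first.
  rewrite (IH _ _ _ N.+1) ?(ltnW ltnN) // mulr_sumr; apply: eq_bigr => m _.
  rewrite -hmulZr; apply: eq_hmul => // i _.
  by rewrite -[LHS]q_der.
rewrite big_ord_recl [X in X + _]big1 => [|i _]; last by rewrite /hder mulr0 mul0r.
rewrite add0r.
transitivity (hmul (hder r) (fun i => \sum_(m < N) hmul (dpow r m) (q (k.+1 + m)%N) i) n).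
  apply: eq_hmul => // i lein; apply: IH => //; exact: leq_ltn_trans lein ltnN.
rewrite (hmul_sumr _ _ (fun m => hmul (dpow r m) (q (k.+1 + m)%N))).
apply: eq_bigr => m _; rewrite hmulA; apply: eq_hmul => // i _.
by rewrite /= /bump add1n addnS addSn.
Qed.

(** The half of the nonconstant part of sum_n 2^n y(n) z^n/n!. *)
Definition halved (y : nat -> int) (n : nat) : int :=
  if n == 0%N then 0 else 2 ^+ n.-1 * y n.

Lemma dpow_tail_small h m c :
  (c < m.*2)%N -> dpow (tail_from2 h) m c = 0.
Proof.
elim: m c => [|m IH] [|c] //= ltcm; rewrite /hmul big1 // => -[[|i] /= lti] _.
  by rewrite mulr0 mul0r.
by rewrite IH ?mulr0 //; lia.
Qed.

(** A term of degree j of R carries the factor 2^(j-1); over the m factors of a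
    term of degree c in R^m, these exponents add up to c - m. *)
Lemma dvdz_dpow_tail y m c :
  (2 ^+ (c - m) %| dpow (tail_from2 (halved y)) m c)%Z.
Proof.
elim: m c => [|m IH] [|c]; rewrite ?dvdz0 //=.
rewrite rpred_sum // => i _.
have : (2 ^+ (i + (c - i - m)) %| 2 ^+ i * dpow (tail_from2 (halved y)) m (c - i)%N)%Z.
  by rewrite exprD; apply: dvdz_mul.
rewrite subSS => dv.
have {dv} : (2 ^+ (c - m) %| 2 ^+ i * dpow (tail_from2 (halved y)) m (c - i)%N)%Z.
  by apply: dvdz_trans dv; apply: dvdz_exp2l; lia.
move=> dv; rewrite /hder /tail_from2 /halved /=; case: ifP => _.
  by rewrite mulr0 mul0r dvdz0.
by rewrite mulrCA mulrAC dvdz_mulr.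
Qed.

Lemma dpow_1_2 y : dpow (tail_from2 (halved y)) 1 2 = 2 * y 2%N.
Proof. by rewrite /= hmulC hmul1l. Qed.

Lemma dpow_2_4 y : dpow (tail_from2 (halved y)) 2 4 = 3 * (2 * y 2%N) ^+ 2.
Proof.
rewrite -[LHS]/(hmul (hder (tail_from2 (halved y))) (dpow (tail_from2 (halved y)) 1) 3).
rewrite /hmul !big_ord_recl big_ord0 dpow_1_2.
have d11 := @dpow_tail_small (halved y) 1 1 isT.
have d10 := @dpow_tail_small (halved y) 1 0 isT.
rewrite d11 d10 /hder /tail_from2 /halved /= mulr0 mul0r !mulr0 !addr0 add0r.
by rewrite (_ : bump 0 0 = 1%N) // bin1 expr1; ring.
Qed.

(** * Binomial coefficients at n + 2^e *)

(** From i 'C(2^e, i) = 2^e 'C(2^e - 1, i - 1), where the power of 2 in i is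
    smaller than 2^d. *)
Lemma dvdn_bin_pow2 e d i : (0 < i < 2 ^ d)%N -> (2 ^ e.+1 %| 2 ^ d * 'C(2 ^ e, i))%N.
Proof.
move=> /andP[i_gt0 ltid].
have [o coo Ei] := pfactor_coprime (isT : prime 2) i_gt0.
have ltvd : (logn 2 i < d)%N.
  rewrite -(ltn_exp2l _ _ (isT : 1 < 2)%N); apply: leq_ltn_trans ltid.
  by apply: dvdn_leq => //; apply: pfactor_dvdnn.
apply: (@dvdn_trans (2 ^ (logn 2 i).+1 * 'C(2 ^ e, i))%N); last first.
  by rewrite dvdn_mul // dvdn_exp2l.
rewrite !expnS -mulnA dvdn_pmul2l //.
have coeo : coprime (2 ^ e) o by rewrite coprimeXl.
rewrite -(Gauss_dvdr _ coeo) mulnA -Ei.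
case: i i_gt0 {ltid Ei coo ltvd} => // i _.
by rewrite -mul_bin_diag dvdn_mulr.
Qed.

(** In row 2^e the inner binomial coefficients are even, so in the row above
    two neighbours have the same parity. *)
Lemma odd_bin_pow2_pred e j : (j < 2 ^ e)%N -> odd 'C((2 ^ e).-1, j).
Proof.
elim: j => [|j IH] ltj; first by rewrite bin0.
have := @dvdn_bin_pow2 e e j.+1 ltj.
rewrite expnS [(2 * _)%N]mulnC dvdn_pmul2l ?expn_gt0 // dvdn2.
rewrite -{1}(prednK (leq_ltn_trans (leq0n _) ltj)) binS oddD IH ?addbT ?negbK //.
exact: ltnW.
Qed.

Lemma bin_shift e n c :
  ('C(n + 2 ^ e, c)%:Z - 'C(n, c)%:Z
   = \sum_(i < c) 'C(n, i)%:R * 'C(2 ^ e, c - i)%:R).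
Proof.
rewrite -binomial.Vandermonde big_ord_recr /= subnn bin0 muln1 PoszD addrK.
by rewrite -[LHS]natz natr_sum; apply: eq_bigr => i _; rewrite natrM.
Qed.

Lemma dvdz_bin_pow2 e d i : (0 < i < 2 ^ d)%N ->
  (2 ^+ e.+1 %| 2 ^+ d * 'C(2 ^ e, i)%:R)%Z.
Proof.
by move=> lti; rewrite -!natrX -natrM !natz dvdzE; apply: dvdn_bin_pow2.
Qed.

Lemma bin_shift_mod e d n c : (c < 2 ^ d)%N ->
  (2 ^+ e.+1 %| 2 ^+ d * ('C(n + 2 ^ e, c)%:Z - 'C(n, c)%:Z))%Z.
Proof.
move=> ltcd; rewrite bin_shift mulr_sumr rpred_sum // => i _.
rewrite mulrCA dvdz_mull // dvdz_bin_pow2 // subn_gt0 ltn_ord.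
exact: leq_ltn_trans (leq_subr _ _) ltcd.
Qed.

(** In Vandermonde's sum the terms other than 'C(2^e, 2^d) vanish as in
    [bin_shift_mod], and 2^d 'C(2^e, 2^d) = 2^e 'C(2^e - 1, 2^d - 1) is an odd
    multiple of 2^e. *)
Lemma bin_shift_pow2_mod e d n : (d <= e)%N ->
  (2 ^+ e.+1 %| 2 ^+ d * ('C(n + 2 ^ e, 2 ^ d)%:Z - 'C(n, 2 ^ d)%:Z) - 2 ^+ e)%Z.
Proof.
move=> lede; rewrite bin_shift.
have [D ED] : exists D, (2 ^ d)%N = D.+1 by exists (2 ^ d).-1; rewrite prednK ?expn_gt0.
have [E EE] : exists E, (2 ^ e)%N = E.+1 by exists (2 ^ e).-1; rewrite prednK ?expn_gt0.
rewrite ED big_ord_recl bin0 mul1r subn0 mulrDr addrAC rpredD //.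
  have oddC : odd 'C(E, D).
    have := @odd_bin_pow2_pred e D; rewrite EE; apply.
    by rewrite -EE -ED leq_exp2l.
  have -> : 2 ^+ d * 'C(2 ^ e, D.+1)%:R - 2 ^+ e = 2 ^+ e * ('C(E, D)%:Z - 1) :> int.
    rewrite mulrBr mulr1; congr (_ - _).
    by rewrite -!natrX -natrM ED EE -[X in _ * X]natz -natrM mul_bin_diag.
  rewrite exprSr dvdz_mul //; lia.
rewrite mulr_sumr rpred_sum // => i _.
rewrite mulrCA dvdz_mull // dvdz_bin_pow2 // subn_gt0 ltn_ord ED /=.
by rewrite /bump add1n subSS; apply: leq_ltn_trans (leq_subr _ _) _.
Qed.

(** * Periodicity *)

Lemma double_lt_exp2 d : (2 < d)%N -> (d.*2 < 2 ^ d)%N.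
Proof.
elim: d => [//|d IH]; rewrite ltnS leq_eqVlt => /orP[/eqP <- //|lt2d].
by have := IH lt2d; rewrite expnS; lia.
Qed.

Lemma even_3sqrB (a : int) : (2 %| 3 * a ^+ 2 - a)%Z.
Proof.
have [d [->|->]] : exists d, a = 2 * d \/ a = 2 * d + 1 by exists (a %/ 2)%Z; lia.
- by apply/dvdzP; exists (6 * d ^+ 2 - d); ring.
- by apply/dvdzP; exists (6 * d ^+ 2 + 5 * d + 1); ring.
Qed.

Lemma sum_indicator N j : (j < N)%N ->
  \sum_(c < N) (c == j :> nat)%:R = 1 :> int.
Proof.
move=> ltjN; rewrite (bigD1 (Ordinal ltjN)) //= eqxx big1 ?addr0 // => i.
by rewrite -val_eqE /= => /negPf ->.
Qed.

(** Among the pairs with c >= 2m, those for which c < 2^(c-m) fails. *)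
Definition exceptional (m c : nat) : bool :=
  (m == 1%N) && (c == 2%N) || (m == 2%N) && (c == 4%N).

(** In the exceptional cases W(1, 2) = 2 y(2) and W(2, 4) = 12 y(2)^2, and
    3 y(2)^2 has the parity of y(2).  For the other pairs with c >= 2m >= 2 put
    d = c - m; then d >= m, hence c <= 2d, which is less than 2^d if d >= 3;
    for d = 2 there only remains c = 3. *)
Lemma bin_dpow_tail_mod y e n m c : (1 < e)%N ->
  (2 ^+ e.+1 %| ('C(n + 2 ^ e, c)%:Z - 'C(n, c)%:Z) * dpow (tail_from2 (halved y)) m c
     - (exceptional m c)%:R * (2 ^+ e * y 2%N))%Z.
Proof.
move=> e_gt1.
have [ltcm|le2mc] := ltnP c m.*2.
  rewrite dpow_tail_small // mulr0 /exceptional.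
  have -> /= : ((m == 1) && (c == 2) || (m == 2) && (c == 4) = false)%N by lia.
  by rewrite mul0r subrr dvdz0.
have [/andP[/eqP-> /eqP->]|not12] := boolP ((m == 1) && (c == 2))%N.
  rewrite dpow_1_2 mul1r.
  have := @bin_shift_pow2_mod e 1 n (ltnW e_gt1); rewrite expn1 expr1.
  move=> /(dvdz_mulr (y 2%N)); congr (_ %| _)%Z; ring.
have [/andP[/eqP-> /eqP->]|not24] := boolP ((m == 2) && (c == 4))%N.
  rewrite dpow_2_4 mul1r.
  have := @bin_shift_pow2_mod e 2 n e_gt1; rewrite -[(2 ^ 2)%N]/4%N.
  move=> /(dvdz_mulr (3 * y 2%N ^+ 2)) dv.
  have := dvdz_mul (dvdzz (2 ^+ e)) (even_3sqrB (y 2%N)); rewrite -exprSr.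
  move=> /(rpredD dv); congr (_ %| _)%Z; ring.
rewrite /exceptional (negPf not12) (negPf not24) mul0r subr0.
have [->|c_gt0] := posnP c; first by rewrite !bin0 subrr mul0r dvdz0.
have [m0|m_gt0] := posnP m.
  by rewrite m0 /= /hone (gtn_eqF c_gt0) mulr0 dvdz0.
have /dvdzP[w ->] := dvdz_dpow_tail y m c.
rewrite mulrCA dvdz_mull // mulrC bin_shift_mod //.
have [ltd|led] := ltnP 2 (c - m).
  by apply: leq_ltn_trans (double_lt_exp2 ltd); lia.
have [-> ->] : m = 1%N /\ c = 3%N by lia.
by [].
Qed.

(** In the double sum for half_pow the terms of [bin_dpow_tail_mod] are multiplied
    by odd numbers of period 2^(s+2), and the two exceptional ones cancel. *)
Lemma half_pow_periodic y k n s : odd `|y 1%N|%N ->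
  (2 ^+ s.+3 %| half_pow (halved y) k (n + 2 ^ s.+2) - half_pow (halved y) k n)%Z.
Proof.
move=> odd_y1; set M := 2 ^+ s.+3; set L := (2 ^ s.+2)%N; set h := halved y.
have h1 : h 1%N = y 1%N by rewrite /h /halved /= mul1r.
have L_gt0 : (0 < L)%N by rewrite expn_gt0.
pose q m j := y 1%N ^+ j * half_coef (k + m + j).
have q_odd m j : odd `|q m j|%N.
  by rewrite abszM oddM abszX oddX odd_y1 orbT odd_half_coef.
have q_per m j : (M %| q m (j + L)%N - q m j)%Z.
  apply: dvdz_mulB; last by rewrite addnA; apply: half_coef_periodic.
  rewrite exprD -[X in _ - X]mulr1 -mulrBr dvdz_mull //.
  by apply: dvdz_trans (odd_exp_mod s.+2 odd_y1).
have q_perM m j t : (M %| q m (j + L * t)%N - q m j)%Z.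
  elim: t => [|t IH]; first by rewrite muln0 addn0 subrr dvdz0.
  by have := rpredD (q_per m (j + L * t)%N) IH; rewrite addrA subrK mulnSr addnA.
pose W m c := dpow (tail_from2 h) m c.
pose N := (n + L).+1.
(* The exponent n' - c is replaced by n' + (L - 1) c, congruent modulo L, which
   makes sense for c > n' too; so n and n + L have terms for the same c. *)
pose q' n' m c := q m (n' + L.-1 * c)%N.
have expand n' : (n' < N)%N ->
  (M %| half_pow h k n' -
     \sum_(m < N) \sum_(c < N) 'C(n', c)%:Z * W m c * q' n' m c)%Z.
  move=> ltn'N; rewrite (half_pow_split _ _ ltn'N) h1; apply: dvdz_sumB => m.
  have -> : hmul (dpow (tail_from2 h) m) (q m) n' =
      \sum_(c < N) 'C(n', c)%:Z * W m c * q m (n' - c)%N.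
    rewrite /hmul.
    rewrite (big_ord_widen _ (fun c => 'C(n', c)%:R * W m c * q m (n' - c)%N) ltn'N).
    rewrite [RHS](bigID (fun c : 'I_N => (c < n'.+1)%N)) /= [X in _ + X]big1 ?addr0.
      by apply: eq_bigr => c _; rewrite natz.
    by move=> c; rewrite -leqNgt => ltc; rewrite bin_small // !mul0r.
  apply: dvdz_sumB => c; rewrite -mulrBr.
  have [lecn|ltnc] := leqP c n'; last by rewrite bin_small // !mul0r dvdz0.
  rewrite dvdz_mull // -opprB rpredN /q'.
  have -> : (n' + L.-1 * c = n' - c + L * c)%N by nia.
  exact: q_perM.
(* Up to a multiple of M, the increment of half_pow from n to n + L: the factor
   q' keeps its value. *)
pose D := \sum_(m < N) \sum_(c < N)
   ('C(n + L, c)%:Z - 'C(n, c)%:Z) * W m c * q' n m c.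
have dvD : (M %| D)%Z.
  have : (M %| D - \sum_(m < N) \sum_(c < N)
                     (exceptional m c)%:R * (2 ^+ s.+2 * y 2%N))%Z.
    apply: dvdz_sumB => m; apply: dvdz_sumB => c.
    have AW := @bin_dpow_tail_mod y s.+2 n m c isT.
    set B := q' n m c.
    have oddB : (2 %| B - 1)%Z.
      by have := q_odd m (n + L.-1 * c)%N; rewrite -/(q' n m c) -/B; lia.
    have {}oddB : (M %| 2 ^+ s.+2 * (B - 1))%Z.
      by rewrite /M [2 ^+ s.+3]exprSr dvdz_mul.
    have := rpredD (dvdz_mulr B AW) (dvdz_mull ((exceptional m c)%:R * y 2%N) oddB).
    congr (_ %| _)%Z; rewrite /W /h -/L.
    by set A := 'C(n + L, c)%:Z - _; set w := dpow _ _ _; ring.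
  have -> : \sum_(m < N) \sum_(c < N) (exceptional m c)%:R * (2 ^+ s.+2 * y 2%N)
     = M * y 2%N.
    have ind m c : (exceptional m c)%:R = (m == 1%N)%:R * (c == 2%N)%:R
        + (m == 2%N)%:R * (c == 4%N)%:R :> int.
      by rewrite /exceptional; case: m => [|[|[|m]]]; case: c => [|[|[|[|[|c]]]]].
    have N4 : (4 < N)%N by rewrite ltnS /L !expnS; lia.
    under eq_bigr => m _.
      rewrite -mulr_suml.
      under eq_bigr => c _ do rewrite ind.
      rewrite big_split -!mulr_sumr !sum_indicator ?mulr1 //; last by apply: ltn_trans N4.
      over.
    rewrite -mulr_suml big_split !sum_indicator; try by apply: ltn_trans N4.
    by rewrite /M !exprS; ring.
  by move=> dv; have := rpredD dv (dvdz_mulr (y 2%N) (dvdzz M)); rewrite subrK.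
have shift : (M %| \sum_(m < N) \sum_(c < N) 'C(n + L, c)%:Z * W m c * q' (n + L)%N m c
      - \sum_(m < N) \sum_(c < N) 'C(n + L, c)%:Z * W m c * q' n m c)%Z.
  apply: dvdz_sumB => m; apply: dvdz_sumB => c; rewrite -mulrBr dvdz_mull //.
  by rewrite /q' addnAC q_per.
have DE : D = \sum_(m < N) \sum_(c < N) 'C(n + L, c)%:Z * W m c * q' n m c
      - \sum_(m < N) \sum_(c < N) 'C(n, c)%:Z * W m c * q' n m c.
  rewrite /D -sumrB; apply: eq_bigr => m _; rewrite -sumrB; apply: eq_bigr => c _.
  ring.
have ltN : (n < N)%N by rewrite ltnS leq_addr.
have := rpredB (rpredD (rpredD (expand (n + L)%N (ltnSn _)) shift) dvD) (expand n ltN).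
by rewrite DE; congr (_ %| _)%Z; ring.
Qed.

Theorem theorem31 (x : nat -> int)
    (x0 : x 0%N = 1) (x1_odd : odd `|x 1%N|%N) (x2_odd : odd `|x 2%N|%N) :
  exists v : nat -> int,
    is_fps_sqrt (expansion v) (radicand x) /\
    forall e : nat, (3 <= e)%N ->
      purely_periodic_mod v (2 ^+ e) (2 ^ (e - 1)).
Proof.
pose g (x : nat -> int) i := if odd i then 0 else halved x i./2.
have g_odd z i : odd i -> g z i = 0 by rewrite /g => ->.
have g_even z i : g z i.*2 = halved z i by rewrite /g odd_double doubleK.
exists (fun n => half_pow (g x) 0 n.*2); split.
  apply: expansion_sqrt => // [|n]; first by rewrite half_pow_at0 /half_coef big_ord0.
  rewrite -hmul_even => [|i oddi]; last by rewrite half_pow_odd // => j /g_odd.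
  rewrite half_pow_sqr // /one_plus_double g_even /halved /hone.
  case: n => [|n] //=; first by rewrite x0.
  by rewrite add0r exprS mulrA.
case=> [|[|[|s]]] // _ n; apply/eqP; rewrite eqz_mod_dvd subn1 /=.
set M := 2 ^+ s.+3.
(* The inverse of an odd number modulo 2^(s+3) is its power of exponent
   2^(s+3) - 1. *)
pose y i := x i * (odd_fact i)%:Z ^+ (2 ^ s.+3).-1.
have xy i : (M %| (odd_fact i)%:Z * halved y i - halved x i)%Z.
  rewrite /halved; case: eqP => _; first by rewrite mulr0 subrr dvdz0.
  have -> : (odd_fact i)%:Z * (2 ^+ i.-1 * y i) - 2 ^+ i.-1 * x i =
     2 ^+ i.-1 * x i * ((odd_fact i)%:Z ^+ (2 ^ s.+3) - 1).
    rewrite /y -[in X in _ ^+ X - 1](prednK (_ : 0 < 2 ^ s.+3)%N) ?expn_gt0 // exprS.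
    ring.
  rewrite dvdz_mull //.
  apply: dvdz_trans (@odd_exp_mod (odd_fact i)%:Z s.+3 (odd_odd_fact i)).
  by rewrite dvdz_exp2l.
pose u := half_pow (halved y) 0.
have vu m : (M %| half_pow (g x) 0 m.*2 - (odd_fact m)%:R * u m)%Z.
  rewrite -(@half_pow_double (fun i =>
    if odd i then 0 else (odd_fact i./2)%:R * halved y i./2)).
  - apply: dvdz_half_powB => i; rewrite /g; case: ifP => _; first by rewrite subrr dvdz0.
    by rewrite -opprB rpredN natz.
  - by move=> i ->.
  - by move=> i; rewrite odd_double doubleK.
have per_u : (M %| (odd_fact (n + 2 ^ s.+2))%:R * u (n + 2 ^ s.+2)%N
                   - (odd_fact n)%:R * u n)%Z.
  apply: dvdz_mulB; first by rewrite !natz odd_fact_periodic.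
  apply: half_pow_periodic; rewrite /y abszM oddM x1_odd.
  by rewrite abszX oddX /= odd_odd_fact orbT.
have := rpredB (rpredD (vu (n + 2 ^ s.+2)%N) per_u) (vu n).
by congr (_ %| _)%Z; ring.
Qed.
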